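(* In ABC, parallel composition is associative up to strong bisimilarity: for all ABC expressions $P,Q,R$, $(P|Q)|R\sim P|(Q|R)$.
   Context: ABC (Algebra of Broadcast Communication) is parametrised by sets $\mathcal A$ of agent identifiers, $\mathcal B$ of broadcast names and $\mathcal C$ of handshake communication names. Let $\bar{\mathcal C}=\{\bar c\mid c\in\mathcal C\}$, $H=\mathcal C\cup\bar{\mathcal C}$ (disjoint union), with $\bar{\bar c}=c$; $\mathcal B!=\{b!\mid b\in\mathcal B\}$, $\mathcal B?=\{b?\mid b\in\mathcal B\}$, and $Act=\mathcal B!\cup\mathcal B?\cup H\cup\{\tau\}$ (disjoint union). A relabelling is a function $f$ mapping $\mathcal B$ into $\mathcal B$ and $\mathcal C$ into $\mathcal C$, extended to $Act$ by $f(\bar c)=\overline{f(c)}$, $f(b\sharp)=f(b)\sharp$, $f(\tau)=\tau$. ABC expressions are generated by $0$, $\alpha.E$ ($\alpha\in Act$), $E+F$, $E|F$, $E\backslash c$ ($c\in H$), $E[f]$, and $A\in\mathcal A$; each $A\in\mathcal A$ has a defining equation $A\stackrel{def}{=}P$ with $P$ guarded. The transition relation is the least relation closed under the rules, with $\alpha,\ell\in Act$, $\eta\in H\cup\{\tau\}$, $c\in H$, $b\in\mathcal B$: (Act) $\alpha.E\xrightarrow{\alpha}E$; (Sum-l/r) $E\xrightarrow{\alpha}E'$ implies $E+F\xrightarrow{\alpha}E'$ and $F+E\xrightarrow{\alpha}E'$; (Par-l) $E\xrightarrow{\eta}E'$ implies $E|F\xrightarrow{\eta}E'|F$; (Par-r)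 $F\xrightarrow{\eta}F'$ implies $E|F\xrightarrow{\eta}E|F'$; (Comm) $E\xrightarrow{c}E'$, $F\xrightarrow{\bar c}F'$ imply $E|F\xrightarrow{\tau}E'|F'$; (Bro-l) $E\xrightarrow{b\sharp_1}E'$ ($\sharp_1\in\{!,?\}$) and $F$ has no $b?$-transition imply $E|F\xrightarrow{b\sharp_1}E'|F$; (Bro-r) symmetric; (Bro-c) $E\xrightarrow{b\sharp_1}E'$, $F\xrightarrow{b\sharp_2}F'$ imply $E|F\xrightarrow{b(\sharp_1\circ\sharp_2)}E'|F'$ where $!\circ?=?\circ!=!$, $?\circ?=?$, and $!\circ!$ is undefined; (Rel) $E\xrightarrow{\ell}E'$ implies $E[f]\xrightarrow{f(\ell)}E'[f]$; (Res) $E\xrightarrow{\ell}E'$, $\ell\notin\{c,\bar c\}$ imply $E\backslash c\xrightarrow{\ell}E'\backslash c$; (Rec) $P\xrightarrow{\ell}E'$ and $A\stackrel{def}{=}P$ imply $A\xrightarrow{\ell}E'$. $\sim$ denotes strong bisimilarity on the resulting labelled transition system. *)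

(* Defs.v *)
From Stdlib Require Import Classical_Prop.

Set Implicit Arguments.
Unset Strict Implicit.

Inductive handshake (C : Type) : Type :=
| Name (c : C)
| CoName (c : C).

Definition co (C : Type) (h : handshake C) : handshake C :=
  match h with Name c => CoName c | CoName c => Name c end.

Inductive polarity : Type := Send | Receive.

(* [None] stands for the undefined composite of two sends. *)
Definition pol_comp (s1 s2 : polarity) : option polarity :=
  match s1, s2 with
  | Send, Send => None
  | Receive, Receive => Some Receive
  | _, _ => Some Send
  end.

Inductive act (B C : Type) : Type :=
| Broad (b : B) (s : polarity)
| Hand (h : handshake C)
| Tau.

Arguments Broad {B C} b s.
Arguments Hand {B C} h.
Arguments Tau {B C}.

Record relabelling (B C : Type) : Type := Relabelling {
  relB : B -> B;
  relC : C -> C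
}.

Definition rel_handshake (B C : Type) (f : relabelling B C)
    (h : handshake C) : handshake C :=
  match h with
  | Name c => Name (relC f c)
  | CoName c => CoName (relC f c)
  end.

Definition rel_act (B C : Type) (f : relabelling B C) (l : act B C) :
    act B C :=
  match l with
  | Broad b s => Broad (relB f b) s
  | Hand h => Hand (rel_handshake f h)
  | Tau => Tau
  end.

Inductive expr (A B C : Type) : Type :=
| Nil
| Prefix (l : act B C) (E : expr A B C)
| Sum (E F : expr A B C)
| Par (E F : expr A B C)
| Restrict (E : expr A B C) (c : handshake C)
| Relabel (E : expr A B C) (f : relabelling B C)
| Agent (X : A).

Arguments Nil {A B C}.
Arguments Agent {A B C} X.

(* Every agent identifier occurs within the scope of a prefix. *)
Fixpoint guarded (A B C : Type) (E : expr A B C) : Prop :=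
  match E with
  | Nil => True
  | Prefix _ _ => True
  | Sum E F => guarded E /\ guarded F
  | Par E F => guarded E /\ guarded F
  | Restrict E _ => guarded E
  | Relabel E _ => guarded E
  | Agent _ => False
  end.

Definition rel3 (A B C : Type) : Type :=
  expr A B C -> act B C -> expr A B C -> Prop.

(* The least relation closed under the operational rules when the negative
   premises of the broadcast rules are evaluated in the fixed relation [N];
   [defn X] is the right-hand side of the defining equation of [X]. *)
Inductive derivable (A B C : Type) (defn : A -> expr A B C) (N : rel3 A B C) :
    expr A B C -> act B C -> expr A B C -> Prop :=
| rule_act (l : act B C) (E : expr A B C) :
    derivable defn N (Prefix l E) l E
| rule_sum_l (E F E' : expr A B C) (l : act B C) :
    derivable defn N E l E' ->
    derivable defn N (Sum E F) l E'
| rule_sum_r (E F F' : expr A B C) (l : act B C) :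
    derivable defn N F l F' ->
    derivable defn N (Sum E F) l F'
| rule_par_l (E F E' : expr A B C) (eta : act B C) :
    (eta = Tau \/ exists h, eta = Hand h) ->
    derivable defn N E eta E' ->
    derivable defn N (Par E F) eta (Par E' F)
| rule_par_r (E F F' : expr A B C) (eta : act B C) :
    (eta = Tau \/ exists h, eta = Hand h) ->
    derivable defn N F eta F' ->
    derivable defn N (Par E F) eta (Par E F')
| rule_comm (E F E' F' : expr A B C) (c : handshake C) :
    derivable defn N E (Hand c) E' ->
    derivable defn N F (Hand (co c)) F' ->
    derivable defn N (Par E F) Tau (Par E' F')
| rule_bro_l (E F E' : expr A B C) (b : B) (s : polarity) :
    derivable defn N E (Broad b s) E' ->
    (forall F', ~ N F (Broad b Receive) F') ->
    derivable defn N (Par E F) (Broad b s) (Par E' F)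
| rule_bro_r (E F F' : expr A B C) (b : B) (s : polarity) :
    (forall E', ~ N E (Broad b Receive) E') ->
    derivable defn N F (Broad b s) F' ->
    derivable defn N (Par E F) (Broad b s) (Par E F')
| rule_bro_c (E F E' F' : expr A B C) (b : B) (s1 s2 s : polarity) :
    derivable defn N E (Broad b s1) E' ->
    derivable defn N F (Broad b s2) F' ->
    pol_comp s1 s2 = Some s ->
    derivable defn N (Par E F) (Broad b s) (Par E' F')
| rule_rel (E E' : expr A B C) (f : relabelling B C) (l : act B C) :
    derivable defn N E l E' ->
    derivable defn N (Relabel E f) (rel_act f l) (Relabel E' f)
| rule_res (E E' : expr A B C) (c : handshake C) (l : act B C) :
    derivable defn N E l E' ->
    l <> Hand c -> l <> Hand (co c) ->
    derivable defn N (Restrict E c) l (Restrict E' c)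
| rule_rec (X : A) (E' : expr A B C) (l : act B C) :
    derivable defn N (defn X) l E' ->
    derivable defn N (Agent X) l E'.

(* With negative premises "the least relation closed under the rules" cannot
   be read as an intersection of all closed relations.  It is the relation [T]
   that is least among those closed under the rules with the negative premises
   evaluated in [T] itself. *)
Definition is_transition_relation (A B C : Type) (defn : A -> expr A B C)
    (T : rel3 A B C) : Prop :=
  forall E l E', T E l E' <-> derivable defn T E l E'.

(* The transition relation.  For guarded defining equations there is exactly
   one [T] with [is_transition_relation defn T], namely this one: see
   [trans_is_transition_relation] and [trans_unique]. *)
Definition trans (A B C : Type) (defn : A -> expr A B C) : rel3 A B C :=
  fun E l E' =>
    forall T : rel3 A B C, is_transition_relation defn T -> T E l E'.

Definition bisimulation (A B C : Type) (defn : A -> expr A B C)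
    (S : expr A B C -> expr A B C -> Prop) : Prop :=
  forall E F, S E F ->
    (forall l E', trans defn E l E' ->
       exists F', trans defn F l F' /\ S E' F') /\
    (forall l F', trans defn F l F' ->
       exists E', trans defn E l E' /\ S E' F').

Definition bisimilar (A B C : Type) (defn : A -> expr A B C)
    (E F : expr A B C) : Prop :=
  exists S, bisimulation defn S /\ S E F.

(* Auxiliary, only for existence and uniqueness: the ability to receive on a
   broadcast name has a characterization without negative premises. *)
Inductive can_receive (A B C : Type) (defn : A -> expr A B C) :
    expr A B C -> B -> Prop :=
| recv_act b E : can_receive defn (Prefix (Broad b Receive) E) b
| recv_sum_l E F b : can_receive defn E b -> can_receive defn (Sum E F) b
| recv_sum_r E F b : can_receive defn F b -> can_receive defn (Sum E F) b
| recv_par_l E F b : can_receive defn E b -> can_receive defn (Par E F) b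
| recv_par_r E F b : can_receive defn F b -> can_receive defn (Par E F) b
| recv_rel E f b :
    can_receive defn E b -> can_receive defn (Relabel E f) (relB f b)
| recv_res E c b : can_receive defn E b -> can_receive defn (Restrict E c) b
| recv_rec X b : can_receive defn (defn X) b -> can_receive defn (Agent X) b.

Lemma derivable_can_receive (A B C : Type) (defn : A -> expr A B C)
    (N : rel3 A B C) E l E' :
  derivable defn N E l E' ->
  forall b, l = Broad b Receive -> can_receive defn E b.
Proof.
induction 1 as [l E|E F E' l H IH|E F F' l H IH|E F E' l Hl H IH
  |E F F' l Hl H IH|E F E' F' c H1 IH1 H2 IH2|E F E' b0 s H IH HN
  |E F F' b0 s HN H IH|E F E' F' b0 s1 s2 s H1 IH1 H2 IH2 Hs
  |E E' f l H IH|E E' c l H IH n1 n2|X E' l H IH]; intros b eql.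
- subst l. apply recv_act.
- apply recv_sum_l. auto.
- apply recv_sum_r. auto.
- apply recv_par_l. auto.
- apply recv_par_r. auto.
- discriminate.
- apply recv_par_l. auto.
- apply recv_par_r. auto.
- injection eql as -> ->. destruct s1, s2; try discriminate.
  apply recv_par_l. auto.
- destruct l as [b0 s|h|]; try discriminate.
  injection eql as <- ->. apply recv_rel. auto.
- apply recv_res. auto.
- apply recv_rec. auto.
Qed.

Lemma can_receive_derivable_aux (A B C : Type) (defn : A -> expr A B C)
    (N : rel3 A B C) :
  (forall E b E', N E (Broad b Receive) E' -> can_receive defn E b) ->
  forall E,
  guarded E \/
  (forall X b, can_receive defn (Agent X) b ->
     exists E', derivable defn N (Agent X) (Broad b Receive) E') ->
  forall b, can_receive defn E b ->
    exists E', derivable defn N E (Broad b Receive) E'.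
Proof.
intros HN E.
induction E as [|l E IH|E1 IH1 E2 IH2|E1 IH1 E2 IH2|E IH c|E IH f|X];
  simpl; intros Hg b Hb.
- inversion Hb.
- inversion Hb; subst. eexists. apply rule_act.
- inversion Hb; subst.
  + destruct (IH1 ltac:(tauto) b) as [E' HE']; trivial.
    exists E'. apply rule_sum_l. trivial.
  + destruct (IH2 ltac:(tauto) b) as [E' HE']; trivial.
    exists E'. apply rule_sum_r. trivial.
- specialize (IH1 ltac:(tauto) b). specialize (IH2 ltac:(tauto) b).
  destruct (classic (can_receive defn E1 b)) as [r1|r1];
    destruct (classic (can_receive defn E2 b)) as [r2|r2].
  + destruct (IH1 r1) as [E1' H1]. destruct (IH2 r2) as [E2' H2].
    exists (Par E1' E2'). now apply rule_bro_c with Receive Receive.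
  + destruct (IH1 r1) as [E1' H1]. exists (Par E1' E2).
    apply rule_bro_l; trivial. intros F' HF'. eauto.
  + destruct (IH2 r2) as [E2' H2]. exists (Par E1 E2').
    apply rule_bro_r; trivial. intros F' HF'. eauto.
  + inversion Hb; contradiction.
- inversion Hb; subst. destruct (IH ltac:(tauto) b) as [E' HE']; trivial.
  exists (Restrict E' c). apply rule_res; trivial; discriminate.
- inversion Hb; subst. destruct (IH ltac:(tauto) b0) as [E' HE']; trivial.
  exists (Relabel E' f). exact (rule_rel f HE').
- destruct Hg as [[]|Hg]. auto.
Qed.

Lemma can_receive_derivable (A B C : Type) (defn : A -> expr A B C)
    (Hdefn : forall X, guarded (defn X)) (N : rel3 A B C) :
  (forall E b E', N E (Broad b Receive) E' -> can_receive defn E b) ->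
  forall E b, can_receive defn E b ->
    exists E', derivable defn N E (Broad b Receive) E'.
Proof.
intros HN E. apply can_receive_derivable_aux; trivial. right.
intros X b Hb. inversion Hb; subst.
destruct (can_receive_derivable_aux HN (or_introl (Hdefn X)) (b := b))
  as [E' HE']; trivial.
exists E'. apply rule_rec. trivial.
Qed.

Lemma derivable_ext (A B C : Type) (defn : A -> expr A B C)
    (N N' : rel3 A B C) :
  (forall E b E', N' E (Broad b Receive) E' ->
     exists E'', N E (Broad b Receive) E'') ->
  forall E l E', derivable defn N E l E' -> derivable defn N' E l E'.
Proof.
intros HN. induction 1; try (econstructor; eassumption).
- apply rule_bro_l; trivial. intros G HG.
  destruct (HN _ _ _ HG) as [G' HG']. exact (H0 _ HG').
- apply rule_bro_r; trivial. intros G HG.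
  destruct (HN _ _ _ HG) as [G' HG']. exact (H _ HG').
Qed.

Lemma transition_relation_exists (A B C : Type) (defn : A -> expr A B C)
    (Hdefn : forall X, guarded (defn X)) :
  exists T, is_transition_relation defn T.
Proof.
pose (N := fun (E : expr A B C) (l : act B C) (_ : expr A B C) =>
  exists b, l = Broad b Receive /\ can_receive defn E b).
assert (HN : forall E b E',
    N E (Broad b Receive) E' -> can_receive defn E b).
{ intros E b E' [b' [eqb Hb]]. injection eqb as ->. trivial. }
exists (derivable defn N). intros E l E'. split; apply derivable_ext.
- intros F b F' HF. exists F. exists b. split; trivial.
  exact (derivable_can_receive HF eq_refl).
- intros F b F' HF. apply can_receive_derivable; trivial. eauto.
Qed.

Lemma transition_relation_unique (A B C : Type) (defn : A -> expr A B C)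
    (Hdefn : forall X, guarded (defn X)) (T T' : rel3 A B C) :
  is_transition_relation defn T -> is_transition_relation defn T' ->
  forall E l E', T E l E' -> T' E l E'.
Proof.
intros HT HT' E l E' H. apply HT'. apply HT in H. revert H.
apply derivable_ext. intros F b F' HF. apply HT' in HF.
destruct (can_receive_derivable Hdefn (N := T)) with (E := F) (b := b)
  as [G HG].
- intros G c G' HG. apply HT in HG.
  exact (derivable_can_receive HG eq_refl).
- exact (derivable_can_receive HF eq_refl).
- exists G. apply HT. trivial.
Qed.

Lemma trans_unique (A B C : Type) (defn : A -> expr A B C)
    (Hdefn : forall X, guarded (defn X)) (T : rel3 A B C) :
  is_transition_relation defn T ->
  forall E l E', T E l E' <-> trans defn E l E'.
Proof.
intros HT E l E'. split.
- intros H T' HT'. exact (transition_relation_unique Hdefn HT HT' H).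
- intros H. exact (H T HT).
Qed.

Lemma trans_is_transition_relation (A B C : Type) (defn : A -> expr A B C)
    (Hdefn : forall X, guarded (defn X)) :
  is_transition_relation defn (trans defn).
Proof.
destruct (transition_relation_exists Hdefn) as [T HT].
pose proof (trans_unique Hdefn HT) as HU.
intros E l E'. split; intros H.
- apply HU, HT in H. revert H. apply derivable_ext.
  intros F b F' HF. exists F'. apply HU. trivial.
- apply HU, HT. revert H. apply derivable_ext.
  intros F b F' HF. exists F'. apply HU. trivial.
Qed.

(* Main.v *)
Require Import Defs.
From Stdlib Require Import Classical_Prop.

Set Implicit Arguments.
Unset Strict Implicit.

(** Every transition of a parallel composition is obtained by combining one
    contribution of each component, where a component either performs an action
    or stays idle; during a broadcast on [b] it may stay idle only if it cannot
    receive on [b].  The composite is itself idle exactly when both components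
    are, so contributions of nested compositions decompose in the same way, and
    associativity of [|] reduces to associativity of the partial commutative
    operation that combines contributions, with idling as its unit. *)

Definition channel (B C : Type) (l : act B C) : option B :=
  match l with Broad b _ => Some b | _ => None end.

(** [None] stands for idling. A relation, not a function, because composition is partial: [Tau]
    combines only with idling, two sends with nothing. *)
Inductive sync (B C : Type) :
    option (act B C) -> option (act B C) -> option (act B C) -> Prop :=
| sync_idle_l o : sync None o o
| sync_idle_r o : sync o None o
| sync_comm h : sync (Some (Hand h)) (Some (Hand (co h))) (Some Tau)
| sync_bro b s1 s2 s : pol_comp s1 s2 = Some s ->
    sync (Some (Broad b s1)) (Some (Broad b s2)) (Some (Broad b s)).

Lemma co_involutive (C : Type) (h : handshake C) : co (co h) = h.
Proof. now destruct h. Qed.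

Lemma pol_comp_comm s1 s2 : pol_comp s1 s2 = pol_comp s2 s1.
Proof. now destruct s1, s2. Qed.

Lemma sync_sym (B C : Type) (o1 o2 o : option (act B C)) :
  sync o1 o2 o -> sync o2 o1 o.
Proof.
destruct 1 as [o|o|h|b s1 s2 s Hs].
- apply sync_idle_r.
- apply sync_idle_l.
(* The synchronisation is now on [co h], whose complement is [h]. *)
- rewrite <- (co_involutive h) at 2. apply sync_comm.
- apply sync_bro. now rewrite pol_comp_comm.
Qed.

(** Idling is a unit; a handshake yields [Tau], which forces the third contribution to be idle; for
    broadcasts, [pol_comp] is associative as a partial operation. *)
Lemma sync_assoc_r (B C : Type) (o1 o2 o3 o12 o : option (act B C)) :
  sync o1 o2 o12 -> sync o12 o3 o ->
  exists o23, sync o2 o3 o23 /\ sync o1 o23 o.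
Proof.
destruct 1 as [o2|o1|h|b s1 s2 s12 Hs]; intros H.
- exists o. split; [trivial|apply sync_idle_l].
- exists o3. split; [apply sync_idle_l|trivial].
- inversion H; subst. eexists. split; [apply sync_idle_r|apply sync_comm].
- inversion H as [| | |b' s12' s3 s Hs']; subst.
  + eexists. split; [apply sync_idle_r|now apply sync_bro].
  + destruct (pol_comp s2 s3) as [s23|] eqn:Hs23.
    * exists (Some (Broad b s23)). split; apply sync_bro; trivial.
      destruct s1, s2, s3, s12, s23; simpl in *; congruence.
    (* If [s2] and [s3] are both sends, so is [s12], which then cannot combine with [s3]. *)
    * destruct s1, s2, s3, s12; simpl in *; congruence.
Qed.

(** By symmetry, this is [sync_assoc_r] for the triple in reverse order. *)
Lemma sync_assoc_l (B C : Type) (o1 o2 o3 o23 o : option (act B C)) :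
  sync o2 o3 o23 -> sync o1 o23 o ->
  exists o12, sync o1 o2 o12 /\ sync o12 o3 o.
Proof.
intros H23 H.
destruct (sync_assoc_r (sync_sym H23) (sync_sym H)) as [o12 [H12 H3]].
exists o12. split; apply sync_sym; trivial.
Qed.

Section Associativity.

Variables (A B C : Type) (defn : A -> expr A B C).
Hypothesis guarded_defn : forall X : A, guarded (defn X).

Definition deaf (E : expr A B C) (b : B) : Prop :=
  forall E', ~ trans defn E (Broad b Receive) E'.

(** The index [k] is the broadcast name of the whole composite's action, if any. It is passed
    unchanged to all components, so that an idle one is tested for deafness on the right name. *)
Definition contributes (k : option B) (E : expr A B C)
    (o : option (act B C)) (E' : expr A B C) : Prop :=
  match o with
  | Some l => channel l = k /\ trans defn E l E'
  | None => E' = E /\ forall b, k = Some b -> deaf E b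
  end.

Lemma trans_derivable (E E' : expr A B C) (l : act B C) :
  trans defn E l E' -> derivable defn (trans defn) E l E'.
Proof. apply (trans_is_transition_relation guarded_defn). Qed.

Lemma derivable_trans (E E' : expr A B C) (l : act B C) :
  derivable defn (trans defn) E l E' -> trans defn E l E'.
Proof. apply (trans_is_transition_relation guarded_defn). Qed.

(** A receiving component always lets the composite receive: alone if the other one is deaf, jointly
    by [rule_bro_c] otherwise. Conversely, a composite [Receive] is built from receives only. *)
Lemma deaf_par (E F : expr A B C) (b : B) :
  deaf (Par E F) b <-> deaf E b /\ deaf F b.
Proof.
split.
- intros H. apply NNPP. intros Hn.
  destruct (classic (deaf E b)) as [HE|HE];
    destruct (classic (deaf F b)) as [HF|HF].
  + tauto.
  + apply HF. intros F' HF'. apply (H (Par E F')), derivable_trans.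
    apply rule_bro_r; [exact HE|now apply trans_derivable].
  + apply HE. intros E' HE'. apply (H (Par E' F)), derivable_trans.
    apply rule_bro_l; [now apply trans_derivable|exact HF].
  + apply HE. intros E' HE'. apply HF. intros F' HF'.
    apply (H (Par E' F')), derivable_trans.
    apply rule_bro_c with Receive Receive; trivial; now apply trans_derivable.
- intros [HE HF] G HG. apply trans_derivable in HG.
  inversion HG as [| | |? ? ? ? He|? ? ? ? He| |? ? ? ? ? H|? ? ? ? ? _ H
    |? ? ? ? ? s1 s2 ? H1 H2 Hs| | |]; subst.
  + destruct He as [He|[h He]]; discriminate.
  + destruct He as [He|[h He]]; discriminate.
  + apply derivable_trans in H. exact (HE _ H).
  + apply derivable_trans in H. exact (HF _ H).
  + destruct s1, s2; try discriminate.
    apply derivable_trans in H1. exact (HE _ H1).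
Qed.

(** The rules for [Par] correspond to the cases of [sync]; an idle composite is the case settled by
    [deaf_par]. *)
Lemma contributes_par (k : option B) (E F G : expr A B C)
    (o : option (act B C)) :
  contributes k (Par E F) o G <->
  exists o1 o2 E' F', G = Par E' F' /\ contributes k E o1 E' /\
    contributes k F o2 F' /\ sync o1 o2 o.
Proof.
split.
- destruct o as [l|].
  + intros [<- HG]. apply trans_derivable in HG.
    inversion HG as [| | |? ? E' ? He H|? ? F' ? He H|? ? E' F' h H1 H2
      |? ? E' b s H HF|? ? F' b s HE H
      |? ? E' F' b s1 s2 s H1 H2 Hs| | |]; subst.
    * exists (Some l), None, E', F. apply derivable_trans in H.
      repeat split; trivial; try apply sync_idle_r.
      (* The action is no broadcast, so idling carries no deafness condition. *)
      destruct He as [->|[h ->]]; discriminate.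
    * exists None, (Some l), E, F'. apply derivable_trans in H.
      repeat split; trivial; try apply sync_idle_l.
      destruct He as [->|[h ->]]; discriminate.
    * exists (Some (Hand h)), (Some (Hand (co h))), E', F'.
      apply derivable_trans in H1, H2.
      repeat split; trivial. apply sync_comm.
    * exists (Some (Broad b s)), None, E', F. apply derivable_trans in H.
      repeat split; trivial; try apply sync_idle_r.
      intros b' [= <-]. exact HF.
    * exists None, (Some (Broad b s)), E, F'. apply derivable_trans in H.
      repeat split; trivial; try apply sync_idle_l.
      intros b' [= <-]. exact HE.
    * exists (Some (Broad b s1)), (Some (Broad b s2)), E', F'.
      apply derivable_trans in H1, H2.
      repeat split; trivial. now apply sync_bro.
  + intros [-> Hd]. exists None, None, E, F.
    repeat split; try apply sync_idle_l;
      intros b Hb; apply Hd, deaf_par in Hb; tauto.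
- intros (o1 & o2 & E' & F' & -> & H1 & H2 & Hs).
  destruct Hs as [o|o|h|b s1 s2 s Hs].
  + destruct H1 as [-> HE]. destruct o as [l|].
    * destruct H2 as [<- HF]. split; trivial.
      apply derivable_trans. apply trans_derivable in HF.
      destruct l as [b s|h|].
      -- apply rule_bro_r; trivial. exact (HE _ eq_refl).
      -- apply rule_par_r; eauto.
      -- apply rule_par_r; eauto.
    * destruct H2 as [-> HF]. split; trivial.
      intros b Hb. apply deaf_par. auto.
  + destruct H2 as [-> HF]. destruct o as [l|].
    * destruct H1 as [<- HE]. split; trivial.
      apply derivable_trans. apply trans_derivable in HE.
      destruct l as [b s|h|].
      -- apply rule_bro_l; trivial. exact (HF _ eq_refl).
      -- apply rule_par_l; eauto.
      -- apply rule_par_l; eauto.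
    * destruct H1 as [-> HE]. split; trivial.
      intros b Hb. apply deaf_par. auto.
  + destruct H1 as [<- HE], H2 as [_ HF]. split; trivial.
    apply trans_derivable in HE, HF. apply derivable_trans.
    now apply rule_comm with h.
  + destruct H1 as [<- HE], H2 as [_ HF]. split; trivial.
    apply trans_derivable in HE, HF. apply derivable_trans.
    now apply rule_bro_c with s1 s2.
Qed.

Lemma contributes_trans (E E' : expr A B C) (l : act B C) :
  trans defn E l E' <-> contributes (channel l) E (Some l) E'.
Proof. simpl. tauto. Qed.

Definition reassociated (E F : expr A B C) : Prop :=
  exists P Q R, E = Par (Par P Q) R /\ F = Par P (Par Q R).

(** Both sides decompose into the same contributions of [P], [Q] and [R]; only their [sync] is
    rebracketed. *)
Lemma reassociated_bisimulation : bisimulation defn reassociated.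
Proof.
intros E F (P & Q & R & -> & ->). split; intros l G HG;
  apply contributes_trans, contributes_par in HG.
- destruct HG as (o12 & o3 & G' & R' & -> & H12 & H3 & Hs).
  apply contributes_par in H12.
  destruct H12 as (o1 & o2 & P' & Q' & -> & H1 & H2 & Hs').
  destruct (sync_assoc_r Hs' Hs) as (o23 & Hs23 & Hs1).
  exists (Par P' (Par Q' R')). split; [|now exists P', Q', R'].
  apply contributes_trans, contributes_par.
  exists o1, o23, P', (Par Q' R'). repeat split; trivial.
  apply contributes_par. now exists o2, o3, Q', R'.
- destruct HG as (o1 & o23 & P' & G' & -> & H1 & H23 & Hs).
  apply contributes_par in H23.
  destruct H23 as (o2 & o3 & Q' & R' & -> & H2 & H3 & Hs').
  destruct (sync_assoc_l Hs' Hs) as (o12 & Hs12 & Hs3).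
  exists (Par (Par P' Q') R'). split; [|now exists P', Q', R'].
  apply contributes_trans, contributes_par.
  exists o12, o3, (Par P' Q'), R'. repeat split; trivial.
  apply contributes_par. now exists o1, o2, P', Q'.
Qed.

End Associativity.

Theorem theorem2 (A B C : Type) (defn : A -> expr A B C)
    (guarded_defn : forall X : A, guarded (defn X)) (P Q R : expr A B C) :
  bisimilar defn (Par (Par P Q) R) (Par P (Par Q R)).
Proof.
exists (@reassociated A B C).
split; [now apply reassociated_bisimulation|now exists P, Q, R].
Qed.
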